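(* Let $(X,d)$ be a compact metric space and let $f\in Hom(X)$ be such that $\mathcal{GR}(f)\neq X$. If $f$ is topologically stable, then $f$ does not permit $\mathcal{GR}$-explosions.
   Context: $Hom(X)$ is the space of homeomorphisms of $X$ with the uniform topology induced by $d_{\mathscr{C}^0}(f,g)=\max_{x\in X}d(f(x),g(x))$. A strong $\varepsilon$-chain for $f$ from $x$ to $y$ (for the metric $d$) is a finite sequence $(x_i)_{i=1}^n$ ($n\ge1$) in $X$ with $x_1=x$ and, setting $x_{n+1}=y$, $\sum_{i=1}^n d(f(x_i),x_{i+1})<\varepsilon$. $\mathcal{SCR}_d(f)$ is the set of $x\in X$ such that for every $\varepsilon>0$ there is a strong $\varepsilon$-chain from $x$ to $x$. The generalized recurrent set is $\mathcal{GR}(f)=\bigcap_{d'}\mathcal{SCR}_{d'}(f)$, the intersection being over all metrics $d'$ compatible with the topology of $X$. For $f\in Hom(X)$ with $\mathcal{GR}(f)\neq X$, $f$ does not permit $\mathcal{GR}$-explosions if for any open neighborhood $U$ of $\mathcal{GR}(f)$ in $X$ there exists a neighborhood $V$ of $f$ in $Hom(X)$ such that if $g\in V$ then $\mathcal{GR}(g)\subset U$. $f\in Hom(X)$ is topologically stable if there exists a neighborhood $V$ of $f$ in $Hom(X)$ such that for each $g\in V$ there is a continuous function $h_g:X\to X$ satisfying: (i) $h_g\circ g=f\circ h_g$; (ii) $h_g\to id$ as $g\to f$ in the uniform topology. *)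

(* Defs.v *)
From HB Require Import structures.
From mathcomp Require Import all_boot all_order all_algebra.
From mathcomp Require Import all_classical all_reals all_analysis.
From mathcomp Require Import lra.

Set Implicit Arguments.
Unset Strict Implicit.
Unset Printing Implicit Defensive.

Import Order.TTheory GRing.Theory Num.Theory.
Import numFieldNormedType.Exports.

Local Open Scope classical_set_scope.
Local Open Scope ring_scope.

Section c0dist.
Context {R : realType} {X : metricType R}.
Implicit Types f g : X -> X.

(* On a compact space the supremum is a maximum for continuous f and g, see
   [c0dist_max]; on the empty space it is [0]. *)
Definition c0dist f g : R := sup (range (fun x => mdist (f x) (g x))).

Lemma mdist_continuous2 f g : continuous f -> continuous g ->
  continuous (fun x => mdist (f x) (g x)).
Proof.
move=> cf cg x; apply/cvgrPdist_lt => e e0.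
have e20 : 0 < e / 2 by rewrite divr_gt0.
have Nf : \forall y \near x, mdist (f x) (f y) < e / 2.
  exact: (metricType_numDomainType.cvgr_dist_lt (cf x)).
have Ng : \forall y \near x, mdist (g x) (g y) < e / 2.
  exact: (metricType_numDomainType.cvgr_dist_lt (cg x)).
apply: filterS2 Nf Ng => y fy gy.
have := metric_triangle (f x) (f y) (g x).
have := metric_triangle (f y) (g y) (g x).
have := metric_triangle (f y) (f x) (g y).
have := metric_triangle (f x) (g x) (g y).
rewrite (metric_sym (f y) (f x)) (metric_sym (g y) (g x)) => h1 h2 h3 h4.
by rewrite ltr_norml; apply/andP; split; lra.
Qed.

Hypothesis cX : compact [set: X].

Lemma mdist_bounded : exists M : R, forall x y : X, mdist x y <= M.
Proof.
have [[x0 _]|X0] := pselect ([set: X] !=set0); last first.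
  by exists 0 => x; exfalso; apply: X0; exists x.
have c : continuous (fun x : X => mdist x0 x).
  by apply: mdist_continuous2 => x; [exact: cvg_cst|exact: cvg_id].
have /compact_bounded[M [_ MP]] :
    compact ((fun x : X => mdist x0 x) @` [set: X]).
  by apply: continuous_compact => //; exact: continuous_subspaceT.
have {}MP x : mdist x0 x <= M + 1.
  apply: (le_trans (ler_norm _)); have M1 : M < M + 1 by rewrite ltrDl.
  by apply: (MP _ M1); exists x.
exists ((M + 1) + (M + 1)) => x y.
by rewrite (le_trans (metric_triangle x x0 y))// (metric_sym x) lerD.
Qed.

Lemma c0dist_has_ubound f g : has_ubound (range (fun x => mdist (f x) (g x))).
Proof.
by have [M MP] := mdist_bounded; exists M => _ [x _ <-]; exact: MP.
Qed.

Lemma c0dist_ge f g x : mdist (f x) (g x) <= c0dist f g.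
Proof. by apply: ub_le_sup; [exact: c0dist_has_ubound|exists x]. Qed.

Lemma c0dist_le f g M : 0 <= M -> (forall x, mdist (f x) (g x) <= M) ->
  c0dist f g <= M.
Proof.
move=> M0 fgM; rewrite /c0dist.
have [->|/set0P ne] := eqVneq (range (fun x => mdist (f x) (g x))) set0.
  by rewrite sup0.
by apply: ge_sup => // _ [x _ <-].
Qed.

Lemma c0dist_ge0 f g : 0 <= c0dist f g.
Proof.
have [[x _]|X0] := pselect ([set: X] !=set0).
  exact: le_trans (mdist_ge0 _ _) (c0dist_ge f g x).
rewrite /c0dist; have -> : range (fun x => mdist (f x) (g x)) = set0.
  by apply/seteqP; split => // y [x _ _]; apply: X0; exists x.
by rewrite sup0.
Qed.

Lemma c0dist_max f g (x0 : X) : continuous f -> continuous g ->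
  exists x, c0dist f g = mdist (f x) (g x).
Proof.
move=> cf cg; pose k := fun x => mdist (f x) (g x).
have ck : continuous k by exact: mdist_continuous2.
have ckX : compact (k @` [set: X]).
  by apply: continuous_compact => //; exact: continuous_subspaceT.
have cl : closed (k @` [set: X]).
  by apply: compact_closed ckX; exact: Rhausdorff.
have : range k (sup (range k)).
  apply: cl; apply: closure_sup; first by exists (k x0), x0.
  exact: c0dist_has_ubound.
by case=> x _ kx; exists x; rewrite /c0dist -/k -kx.
Qed.

Lemma c0distxx f : c0dist f f = 0.
Proof.
apply/eqP; rewrite eq_le c0dist_ge0 andbT.
by apply: c0dist_le => // x; rewrite mdistxx.
Qed.

Lemma c0dist_eq0 f g : c0dist f g = 0 -> f = g.
Proof.
move=> fg0; apply/funext => x; apply: (@mdist_positivity R).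
by apply/eqP; rewrite eq_le mdist_ge0 andbT -fg0; exact: c0dist_ge.
Qed.

Lemma c0dist_sym f g : c0dist f g = c0dist g f.
Proof.
rewrite /c0dist; congr (sup (image _ _)).
by apply/funext => x; exact: metric_sym.
Qed.

Lemma c0dist_triangle g f h : c0dist f h <= c0dist f g + c0dist g h.
Proof.
apply: c0dist_le => [|x]; first by rewrite addr_ge0 ?c0dist_ge0.
by rewrite (le_trans (metric_triangle _ (g x) _))// lerD ?c0dist_ge.
Qed.

End c0dist.

Definition is_homeo {X : topologicalType} (f : X -> X) : Prop :=
  continuous f /\
  exists2 g : X -> X, continuous g & cancel f g /\ cancel g f.

(* Compactness is a parameter of the type, as the metric structure on it
   depends on compactness. *)
Record homeo {R : realType} {X : metricType R} (cX : compact [set: X]) := Homeo {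
  homeo_fun :> X -> X;
  homeoP : is_homeo homeo_fun
}.

Section homeo_metric.
Context {R : realType} {X : metricType R} (cX : compact [set: X]).

Lemma homeo_inj (f g : homeo cX) : homeo_fun f = homeo_fun g -> f = g.
Proof.
by case: f g => f Hf [g Hg] /= fg; case: _ / fg Hg => Hg; congr Homeo.
Qed.

HB.instance Definition _ := gen_eqMixin (homeo cX).
HB.instance Definition _ := gen_choiceMixin (homeo cX).

HB.instance Definition _ := @isMetric.Build R (homeo cX)
  (fun f g => c0dist f g) (fun f => c0distxx cX f)
  (fun f g fg => homeo_inj (c0dist_eq0 cX fg)) (fun f g => c0dist_sym f g)
  (fun g f h => c0dist_triangle cX g f h).

Lemma homeo_mdistE (f g : homeo cX) : mdist f g = c0dist f g.
Proof. by []. Qed.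

Lemma nbhs_homeoP (f : homeo cX) (V : set (homeo cX)) :
  nbhs f V <-> exists2 e, 0 < e & forall g : homeo cX, c0dist f g < e -> V g.
Proof. by rewrite -metricType_numDomainType.filter_from_mdist_nbhs. Qed.

End homeo_metric.

Section recurrence.
Context {R : realType}.

Record is_metric {T : Type} (d : T -> T -> R) : Prop := IsMetric {
  is_metric_ge0 : forall x y, 0 <= d x y;
  is_metric_eq0 : forall x y, d x y = 0 <-> x = y;
  is_metric_sym : forall x y, d x y = d y x;
  is_metric_triangle : forall x y z, d x z <= d x y + d y z
}.

Definition compatible_metric {X : topologicalType} (d : X -> X -> R) : Prop :=
  is_metric d /\
  forall (x : X) (A : set X),
    nbhs x A <-> exists2 e : R, 0 < e & [set y | d x y < e] `<=` A.

(* The chain (x_1, ..., x_n), n = m + 1, followed by x_{n+1} = y, is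
   (u 0, ..., u m) followed by u (m + 1); later values of u are irrelevant. *)
Definition strong_chain {X : Type} (d : X -> X -> R) (f : X -> X) (e : R)
    (x y : X) : Prop :=
  exists (m : nat) (u : nat -> X),
    [/\ u 0%N = x, u m.+1 = y & \sum_(i < m.+1) d (f (u i)) (u i.+1) < e].

Definition SCR {X : Type} (d : X -> X -> R) (f : X -> X) : set X :=
  [set x | forall e : R, 0 < e -> strong_chain d f e x x].

Definition GR {X : metricType R} (f : X -> X) : set X :=
  \bigcap_(d in @compatible_metric X) SCR d f.

Lemma compatible_mdist (X : metricType R) : compatible_metric (@mdist R X).
Proof.
split; last first.
  by move=> x A; rewrite -metricType_numDomainType.filter_from_mdist_nbhs.
split; [exact: mdist_ge0| |exact: metric_sym|exact: metric_triangle].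
by move=> x y; split=> [|->]; [exact: mdist_positivity|exact: mdistxx].
Qed.

End recurrence.

Section stability.
Context {R : realType} {X : metricType R} {cX : compact [set: X]}.

(* Meant for f with GR f <> setT. *)
Definition no_GR_explosions (f : homeo cX) : Prop :=
  forall U : set X, open U -> GR f `<=` U ->
    exists2 V : set (homeo cX), nbhs f V & forall g, V g -> GR g `<=` U.

(* Only the values of h on the neighborhood V matter. *)
Definition topologically_stable (f : homeo cX) : Prop :=
  exists2 V : set (homeo cX), nbhs f V &
  exists h : homeo cX -> X -> X,
    (forall g, V g -> continuous (h g) /\ h g \o g = f \o h g) /\
    c0dist (h g) id @[g --> f] --> (0 : R).

End stability.

(* Main.v *)
Require Import Defs.
From mathcomp Require Import all_boot all_order all_algebra.
From mathcomp Require Import all_classical all_reals all_analysis.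
From mathcomp Require Import lra.

(** A semiconjugacy [h \o g = f \o h] maps [GR g] into [GR f]: if [d'] is a
  compatible metric on the target, then [d x y + d' (h x) (h y)] is a compatible
  metric on the source, and [h] maps strong chains of [g] for this metric to
  strong chains of [f] for [d'].  Hence every point of [GR g] is moved by [h_g],
  over a distance at most [c0dist h_g id], to a point of [GR f].  As [GR f] is
  closed, thus compact, a uniform neighborhood of it is contained in [U]. *)

Set Implicit Arguments.
Unset Strict Implicit.
Unset Printing Implicit Defensive.

Import Order.TTheory GRing.Theory Num.Theory.
Import numFieldNormedType.Exports.

Local Open Scope classical_set_scope.
Local Open Scope ring_scope.

(** Only the first term of the sum sees the starting point, through its image under [f]; the
    triangle inequality bounds the change. *)
Lemma strong_chain_start (R : realType) (T : Type) (d : T -> T -> R)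
    (f : T -> T) (e : R) (x x' y : T) : is_metric d ->
  strong_chain d f e x y -> strong_chain d f (d (f x') (f x) + e) x' y.
Proof.
move=> dm [m [u [u0 um ue]]].
exists m, (fun i => if i is 0%N then x' else u i); split => //.
rewrite big_ord_recl /= u0 in ue; rewrite big_ord_recl /=.
apply: le_lt_trans (ler_ltD (lexx _) ue).
by rewrite addrA lerD2r; exact: is_metric_triangle.
Qed.

Lemma strong_chain_end (R : realType) (T : Type) (d : T -> T -> R)
    (f : T -> T) (e : R) (x y y' : T) : is_metric d ->
  strong_chain d f e x y -> strong_chain d f (e + d y y') x y'.
Proof.
move=> dm [m [u [u0 um ue]]].
(* The modified index [m.+1] is never 0, so the start is kept and only the last term of the sum
   changes. *)
exists m, (fun i => if i == m.+1 then y' else u i); split => //.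
  by rewrite eqxx.
rewrite big_ord_recr /= um in ue; rewrite big_ord_recr /=.
apply: le_lt_trans (ltr_leD ue (lexx _)).
rewrite eqxx ltn_eqF// -addrA lerD//; last exact: is_metric_triangle.
apply: ler_sum => i _.
by rewrite eqSS !ltn_eqF//= ltnS ltnW.
Qed.

(** Take [y] in [SCR d f] close to [x] with [f y] close to [f x]. Moving both ends of a strong chain
    from [y] to [y] over to [x] costs [d (f x) (f y)] and [d y x], whence the three shares
    [e / 3]. *)
Lemma SCR_closed (R : realType) (X : topologicalType) (d : X -> X -> R)
    (f : X -> X) : compatible_metric d -> continuous f -> closed (SCR d f).
Proof.
move=> [dm dnbhs] cf x clx e e0.
have e30 : 0 < e / 3 by rewrite divr_gt0.
have Nx : nbhs x [set y | d x y < e / 3] by apply/dnbhs; exists (e / 3).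
have Nfx : nbhs x [set y | d (f x) (f y) < e / 3].
  apply: (cf x [set z | d (f x) z < e / 3]).
  by apply/dnbhs; exists (e / 3).
have [y [ySCR [/= xy fxy]]] := clx _ (filterI Nx Nfx).
have /(strong_chain_start x dm)/(strong_chain_end x dm) := ySCR _ e30.
rewrite (is_metric_sym dm y x) => -[m [u [u0 um ue]]].
by exists m, u; split => //; lra.
Qed.

Lemma GR_closed (R : realType) (X : metricType R) (f : X -> X) :
  continuous f -> closed (GR f).
Proof. by move=> cf; apply: closed_bigI => d dX; exact: SCR_closed. Qed.

(** This is the sum metric of the product pulled back along the graph map of [h]. The summand [d]
    separates points and keeps the topology from becoming coarser; continuity of [h] keeps it from
    becoming finer. *)
Lemma compatible_metricD (R : realType) (X Y : topologicalType)
    (d : X -> X -> R) (d' : Y -> Y -> R) (h : X -> Y) :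
  compatible_metric d -> compatible_metric d' -> continuous h ->
  compatible_metric (fun x y => d x y + d' (h x) (h y)).
Proof.
move=> [dm dnbhs] [dm' dnbhs'] ch; split.
  split.
  - by move=> x y; rewrite addr_ge0 ?is_metric_ge0.
  - move=> x y; split=> [/eqP|->].
      rewrite paddr_eq0 ?is_metric_ge0// => /andP[/eqP dxy _].
      exact/(is_metric_eq0 dm).
    rewrite (is_metric_eq0 dm _ _).2// (is_metric_eq0 dm' _ _).2//.
    by rewrite addr0.
  - by move=> x y; rewrite (is_metric_sym dm) (is_metric_sym dm').
  - move=> x y z.
    have := is_metric_triangle dm x y z.
    have := is_metric_triangle dm' (h x) (h y) (h z).
    by move=> h1 h2; lra.
move=> x A; split=> [/dnbhs[e e0 eA]|[e e0 eA]].
  exists e => // y /= xy; apply: eA => /=.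
  by have := is_metric_ge0 dm' (h x) (h y); lra.
have e20 : 0 < e / 2 by rewrite divr_gt0.
have Nx : nbhs x [set y | d x y < e / 2] by apply/dnbhs; exists (e / 2).
have Nhx : nbhs x [set y | d' (h x) (h y) < e / 2].
  apply: (ch x [set z | d' (h x) z < e / 2]).
  by apply/dnbhs'; exists (e / 2).
by apply: filterS2 Nx Nhx => y /= xy hxy; apply: eA => /=; lra.
Qed.

Lemma GR_semiconj (R : realType) (X Y : metricType R) (g : X -> X)
    (f : Y -> Y) (h : X -> Y) : continuous h -> h \o g = f \o h ->
  h @` GR g `<=` GR f.
Proof.
move=> ch hgf _ [x xg <-] d' d'Y e e0.
(* Here it matters that [GR] intersects over all compatible metrics: the one chosen depends on [h]
   and [d']. *)
have := xg _ (compatible_metricD (compatible_mdist X) d'Y ch) _ e0.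
move=> [m [u [u0 um ue]]]; exists m, (h \o u); split; rewrite /= ?u0 ?um//.
apply: le_lt_trans ue; apply: ler_sum => i _.
have -> : f (h (u i)) = h (g (u i)) by have := congr1 (@^~ (u i)) hgf.
by rewrite lerDr mdist_ge0.
Qed.

Lemma compact_open_thickening (R : realType) (X : metricType R) (K U : set X) :
  compact K -> open U -> K `<=` U ->
  exists2 e : R, 0 < e & forall x y, K x -> mdist x y < e -> U y.
Proof.
move=> cK oU KU.
have : \forall e \near (0 : R)^'+,
    K `<=` [set x | forall y, mdist x y < e -> U y].
  apply: (compact_near_coveringP K).1 => // x Kx.
  have [_ nbhsE] := compatible_mdist X.
  have /nbhsE[r r0 rU] : nbhs x U by exact: open_nbhs_nbhs (conj oU (KU _ Kx)).
  have r20 : 0 < r / 2 by rewrite divr_gt0.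
  (* Half the radius lets the center move: a ball of radius below [r / 2] around a point within
     [r / 2] of [x] stays in the [r]-ball at [x]. *)
  exists ([set y | mdist x y < r / 2], [set e | e < r / 2]) => /=.
    by split; [apply/nbhsE; exists (r / 2)|exact: nbhs_right_lt].
  move=> [y e] [/= xy er] z yz; apply: rU => /=.
  by have := metric_triangle x y z; lra.
move=> eU.
have [e [eKU e0]] := filter_ex (filterI eU (nbhs_right_gt (0 : R))).
by exists e => // x y /eKU; exact.
Qed.

Theorem proposition3p2 (R : realType) (X : metricType R)
  (cX : compact [set: X]) (f : homeo cX) :
  GR f <> [set: X] -> topologically_stable f -> no_GR_explosions f.
Proof.
move=> _ [V Vf [h [hV hf]]] U oU GRU.
have [cf _] := homeoP f.
have cGR : compact (GR f) by apply: (subclosed_compact (GR_closed cf) cX).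
have [e e0 eU] := compact_open_thickening cGR oU GRU.
have Nf : nbhs f [set g | c0dist (h g) id < e].
  apply: (hf [set r | r < e]); exact: lt_nbhsl.
(* [V] provides the semiconjugacy, the other set the bound on how far [h g] moves points. *)
exists (V `&` [set g | c0dist (h g) id < e]); first exact: filterI.
move=> g [/hV[chg hgf] hge] x xg.
apply: (eU (h g x)); first by apply: (GR_semiconj chg hgf); exists x.
exact: le_lt_trans (c0dist_ge cX (h g) id x) hge.
Qed.
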